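(* Assume (H0) and (H1). Let $u(t,x)=\min_{y\in\mathbb{R}^n}\{\sigma(y)+tH^*(\frac{x-y}{t})\}$, $(t,x)\in\Omega=(0,T)\times\mathbb{R}^n$. Then for all $(t_0,x_0)\in\Omega$, $$D^*u(t_0,x_0)=\mathcal{H}(t_0,x_0).$$
   Context: Let $T>0$, $H:\mathbb{R}^n\to\mathbb{R}$, $\sigma:\mathbb{R}^n\to\mathbb{R}$. $H^*(z)=\max_{y\in\mathbb{R}^n}\{\langle z,y\rangle-H(y)\}$ is the Fenchel conjugate of $H$; $H^*_z$ denotes the gradient of $H^*$ ($H^*$ is $C^1$ under (H0)). (H0): $H$ is strictly convex on $\mathbb{R}^n$ and superlinear, i.e. $\lim_{\|p\|\to\infty}H(p)/\|p\|=+\infty$. (H1): $\sigma$ is continuous on $\mathbb{R}^n$ and for every $(t_0,x_0)\in[0,T)\times\mathbb{R}^n$ there exist constants $r,N>0$ such that $\min_{\|y\|\le N}\{\sigma(y)+tH^*(\frac{x-y}{t})\}<\sigma(z)+tH^*(\frac{x-z}{t})$ whenever $\|z\|>N$, $t\in(0,T)$ and $|t-t_0|+\|x-x_0\|<r$. For $(t,x)\in\Omega$, $\ell(t,x)$ is the (nonempty) set of global minimizers over $y\in\mathbb{R}^n$ of $y\mapsto\sigma(y)+tH^*(\frac{x-y}{t})$. The set of reachable gradients $D^*u(t_0,x_0)$ consists of all $(p,q)\in\mathbb{R}\times\mathbb{R}^n$ for which there is a sequence $(t_k,x_k)\in\Omega\setminus\{(t_0,x_0)\}$ such that $u$ is differentiable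 at each $(t_k,x_k)$, $(t_k,x_k)\to(t_0,x_0)$ and $(u_t(t_k,x_k),u_x(t_k,x_k))\to(p,q)$ as $k\to\infty$. $\mathcal{H}(t_0,x_0)=\{(-H(q),q):\ q=H^*_z(\frac{x_0-y_0}{t_0}),\ y_0\in\ell(t_0,x_0)\}$ (any such $q$ automatically belongs to the subdifferential $D^-\sigma(y_0)=\{p:\liminf_{h\to0}\frac{\sigma(y_0+h)-\sigma(y_0)-\langle p,h\rangle}{|h|}\ge0\}$). *)

(* Defs.v *)
From HB Require Import structures.
From mathcomp Require Import all_boot all_order all_algebra.
From mathcomp Require Import all_classical all_reals all_analysis.

Set Implicit Arguments.
Unset Strict Implicit.
Unset Printing Implicit Defensive.

Import Order.TTheory GRing.Theory Num.Theory.
Import numFieldNormedType.Exports.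

Local Open Scope classical_set_scope.
Local Open Scope ring_scope.

Definition dotv (R : realType) (n : nat) (x y : 'rV[R]_n) : R :=
  \sum_(i < n) x 0 i * y 0 i.

(* The library norm on 'rV[R]_n is the sup norm; it induces the same topology
   and the same differentiability as the Euclidean norm below. *)
Definition enorm (R : realType) (n : nat) (x : 'rV[R]_n) : R :=
  Num.sqrt (dotv x x).

Definition grad (R : realType) (n : nat) (f : 'rV[R]_n -> R) (x : 'rV[R]_n) :
    'rV[R]_n :=
  \row_(i < n) 'D_(delta_mx 0 i) f x.

Definition strictly_convex (R : realType) (n : nat) (H : 'rV[R]_n -> R) : Prop :=
  forall (x y : 'rV[R]_n) (a : R), x != y -> 0 < a < 1 ->
    H (a *: x + (1 - a) *: y) < a * H x + (1 - a) * H y.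

(* H p / ||p|| --> +oo as ||p|| --> +oo *)
Definition superlinear (R : realType) (n : nat) (H : 'rV[R]_n -> R) : Prop :=
  forall A : R, exists B : R, forall p : 'rV[R]_n,
    B < enorm p -> A < H p / enorm p.

Definition condH0 (R : realType) (n : nat) (H : 'rV[R]_n -> R) : Prop :=
  strictly_convex H /\ superlinear H.

(* The real-valued [sup] and [inf] used in [conjugate], [condH1] and [hopf_lax] are
   meaningful only for sets that are nonempty and bounded on the relevant side;
   under [condH0] and [condH1] the extrema are attained for t in ]0, T[. *)
Definition conjugate (R : realType) (n : nat) (H : 'rV[R]_n -> R)
    (z : 'rV[R]_n) : R :=
  sup [set dotv z y - H y | y in [set: 'rV[R]_n]].

Definition cost (R : realType) (n : nat) (H sigma : 'rV[R]_n -> R)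
    (t : R) (x y : 'rV[R]_n) : R :=
  sigma y + t * conjugate H (t^-1 *: (x - y)).

Definition condH1 (R : realType) (n : nat) (T : R) (H sigma : 'rV[R]_n -> R) :
    Prop :=
  continuous sigma /\
  forall (t0 : R) (x0 : 'rV[R]_n), 0 <= t0 < T ->
    exists r N : R, [/\ 0 < r, 0 < N &
      forall (t : R) (x z : 'rV[R]_n),
        N < enorm z -> 0 < t < T -> `|t - t0| + enorm (x - x0) < r ->
        inf [set cost H sigma t x y | y in [set y | enorm y <= N]]
          < cost H sigma t x z].

Definition Omega (R : realType) (n : nat) (T : R) : set (R * 'rV[R]_n) :=
  [set tx | 0 < tx.1 < T].

Definition hopf_lax (R : realType) (n : nat) (H sigma : 'rV[R]_n -> R)
    (tx : R * 'rV[R]_n) : R :=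
  inf [set cost H sigma tx.1 tx.2 y | y in [set: 'rV[R]_n]].

Definition ell (R : realType) (n : nat) (H sigma : 'rV[R]_n -> R)
    (t : R) (x : 'rV[R]_n) : set 'rV[R]_n :=
  [set y | forall z : 'rV[R]_n, cost H sigma t x y <= cost H sigma t x z].

Definition partial_t (R : realType) (n : nat) (u : R * 'rV[R]_n -> R)
    (tx : R * 'rV[R]_n) : R :=
  derive1 (fun t : R => u (t, tx.2)) tx.1.

Definition partial_x (R : realType) (n : nat) (u : R * 'rV[R]_n -> R)
    (tx : R * 'rV[R]_n) : 'rV[R]_n :=
  grad (fun x : 'rV[R]_n => u (tx.1, x)) tx.2.

(* [u] is a total function, but [Omega] is open, so only the values of [u] on
   [Omega] matter here. *)
Definition reachable_gradients (R : realType) (n : nat) (T : R)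
    (u : R * 'rV[R]_n -> R) (tx0 : R * 'rV[R]_n) : set (R * 'rV[R]_n) :=
  [set pq | exists s : nat -> R * 'rV[R]_n,
    [/\ forall k, Omega T (s k) /\ s k != tx0,
        forall k, differentiable u (s k),
        s k @[k --> \oo] --> tx0 &
        (partial_t u (s k), partial_x u (s k)) @[k --> \oo] --> pq]].

Definition calH (R : realType) (n : nat) (H sigma : 'rV[R]_n -> R)
    (t0 : R) (x0 : 'rV[R]_n) : set (R * 'rV[R]_n) :=
  [set pq | exists2 y0 : 'rV[R]_n, ell H sigma t0 x0 y0 &
    let q := grad (conjugate H) (t0^-1 *: (x0 - y0)) in pq = (- H q, q)].

(* Main.v *)
From HB Require Import structures.
Require Import Defs.
From mathcomp Require Import all_boot all_order all_algebra.
From mathcomp Require Import all_classical all_reals all_analysis.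
From mathcomp Require Import ring lra.

(** Write [q(z)] for the maximiser of [v |-> <z,v> - H v].  Superlinearity makes
    it exist, strict convexity makes it unique, and a compactness argument
    makes it continuous in [z]; this gives that [H^*] is differentiable with
    [grad H^* = q] ([grad_conjugate]).  The cost is
    [sigma y + P(t, x - y)] with [P(t,x) = t H^*(x/t)] the perspective of
    [H^*].  Being the supremum of the linear forms
    [(t,x) |-> <x,q> - t H(q)], the function [P] is above each of them and
    subadditive, and near a point with [t > 0] it exceeds the form with
    [q = q(x/t)] only by [o] of the increment ([perspective_le_near]).

    Two consequences for [u].  If [y] minimises the cost at [(t,x)], then
    near [(t,x)] the function [u] is at most [sigma y + P(., . - y)], with
    equality at [(t,x)]; so wherever [u] is differentiable its gradient is
    [(- H q, q)] with [q = q((x-y)/t)] ([hopf_lax_gradient]).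
    If [y0] minimises the cost at [(t0,x0)], then subadditivity of [P] gives
    [u(s,w) >= u(t0,x0) - P(t0-s, x0-w)] for [s < t0].  At a point
    [(t, y0 + t z)], [z = (x0-y0)/t0], of the open segment from [(0,y0)] to
    [(t0,x0)], this lower bound and the previous upper bound touch [u] and have
    the same first-order expansion, since both perspectives are expanded at the
    velocity [z].  So [u] is differentiable at all these points
    ([hopf_lax_differentiable]), whether or not the minimiser at [(t0,x0)] is
    unique, and its gradient there is constant.

    Hence every element of [calH] is reached by letting [t] increase to [t0]
    along that segment.  Conversely, along a sequence realising a reachable
    gradient, the minimisers stay in a fixed ball by (H1); any of their limit
    points minimises the cost at [(t0,x0)], and continuity of [q] and [H]
    identifies the limit of the gradients. *)

Set Implicit Arguments.
Unset Strict Implicit.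
Unset Printing Implicit Defensive.

Import Order.TTheory GRing.Theory Num.Theory.
Import numFieldNormedType.Exports.
Local Open Scope classical_set_scope.
Local Open Scope ring_scope.

(** * The scalar product and the two norms *)

Lemma dotvDl (R : realType) (n : nat) (x y z : 'rV[R]_n) :
  dotv (x + y) z = dotv x z + dotv y z.
Proof.
rewrite /dotv -big_split; apply: eq_bigr => i _.
by rewrite mxE mulrDl.
Qed.

Lemma dotvZl (R : realType) (n : nat) (a : R) (x y : 'rV[R]_n) :
  dotv (a *: x) y = a * dotv x y.
Proof.
rewrite /dotv mulr_sumr; apply: eq_bigr => i _.
by rewrite mxE mulrA.
Qed.

Lemma dotvC (R : realType) (n : nat) (x y : 'rV[R]_n) : dotv x y = dotv y x.
Proof. by apply: eq_bigr => i _; rewrite mulrC. Qed.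

Lemma dotvDr (R : realType) (n : nat) (x y z : 'rV[R]_n) :
  dotv x (y + z) = dotv x y + dotv x z.
Proof. by rewrite dotvC dotvDl ![dotv _ x]dotvC. Qed.

Lemma dotvZr (R : realType) (n : nat) (a : R) (x y : 'rV[R]_n) :
  dotv x (a *: y) = a * dotv x y.
Proof. by rewrite dotvC dotvZl dotvC. Qed.

Lemma dotvBl (R : realType) (n : nat) (x y z : 'rV[R]_n) :
  dotv (x - y) z = dotv x z - dotv y z.
Proof. by rewrite -scaleN1r dotvDl dotvZl mulN1r. Qed.

Lemma dotvBr (R : realType) (n : nat) (x y z : 'rV[R]_n) :
  dotv x (y - z) = dotv x y - dotv x z.
Proof. by rewrite dotvC dotvBl ![dotv _ x]dotvC. Qed.

Lemma dotv0l (R : realType) (n : nat) (x : 'rV[R]_n) : dotv 0 x = 0.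
Proof. by rewrite -(scale0r (0 : 'rV[R]_n)) dotvZl mul0r. Qed.

Lemma dotv0r (R : realType) (n : nat) (x : 'rV[R]_n) : dotv x 0 = 0.
Proof. by rewrite dotvC dotv0l. Qed.

Lemma dotv_deltal (R : realType) (n : nat) (i : 'I_n) (x : 'rV[R]_n) :
  dotv (delta_mx 0 i) x = x 0 i.
Proof.
rewrite /dotv (bigD1 i) //= mxE !eqxx mul1r big1 ?addr0 // => j ji.
by rewrite mxE (negbTE ji) andbF mul0r.
Qed.

Lemma coord_le_norm (R : realType) (n : nat) (x : 'rV[R]_n) (i : 'I_n) :
  `|x 0 i| <= `|x|.
Proof.
by rewrite [leRHS]mx_normrE; apply: (le_bigmax _ _ (ord0, i)).
Qed.

Lemma norm_le_coord (R : realType) (n : nat) (x : 'rV[R]_n) (c : R) :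
  0 <= c -> (forall i, `|x 0 i| <= c) -> `|x| <= c.
Proof.
move=> c0 xc; rewrite [leLHS]mx_normrE; apply: bigmax_le => // -[i j] _ /=.
by rewrite ord1.
Qed.

(** This lets the Euclidean norm of the hypotheses control the sup norm, which
    defines the topology. *)
Lemma norm_le_enorm (R : realType) (n : nat) (x : 'rV[R]_n) :
  `|x| <= enorm x.
Proof.
apply: norm_le_coord => [|i]; first exact: sqrtr_ge0.
rewrite -sqrtr_sqr; apply: ler_wsqrtr.
rewrite /dotv (bigD1 i) //= expr2 lerDl.
by apply: sumr_ge0 => j _; rewrite -expr2 sqr_ge0.
Qed.

(** A crude substitute for Cauchy-Schwarz in the sup norm: only the
    existence of some constant matters below. *)
Lemma norm_dotv_le (R : realType) (n : nat) (x y : 'rV[R]_n) :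
  `|dotv x y| <= n%:R * `|x| * `|y|.
Proof.
rewrite /dotv (le_trans (ler_norm_sum _ _ _))//.
have -> : n%:R * `|x| * `|y| = \sum_(i < n) `|x| * `|y|.
  by rewrite sumr_const card_ord -mulrA mulr_natl.
by apply: ler_sum => i _; rewrite normrM ler_pM// coord_le_norm.
Qed.

Lemma enorm0 (R : realType) (n : nat) : enorm (0 : 'rV[R]_n) = 0.
Proof. by rewrite /enorm dotv0l sqrtr0. Qed.

Lemma cvg_dotv (R : realType) (n : nat) (T : Type) (F : set_system T)
    (FF : Filter F) (f g : T -> 'rV[R]_n) (a b : 'rV[R]_n) :
  f @ F --> a -> g @ F --> b -> dotv (f x) (g x) @[x --> F] --> dotv a b.
Proof.
move=> fa gb; rewrite /dotv; apply: cvg_big => [|i _]; first exact: add_continuous.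
apply: cvgM.
  by apply: (cvg_comp f (fun y : 'rV[R]_n => y 0 i) fa); exact: coord_continuous.
by apply: (cvg_comp g (fun y : 'rV[R]_n => y 0 i) gb); exact: coord_continuous.
Qed.

Lemma cvg_enorm (R : realType) (n : nat) (T : Type) (F : set_system T)
    (FF : Filter F) (f : T -> 'rV[R]_n) (a : 'rV[R]_n) :
  f @ F --> a -> enorm (f x) @[x --> F] --> enorm a.
Proof.
move=> fa; apply: (cvg_comp (fun x => dotv (f x) (f x)) Num.sqrt).
  exact: (cvg_dotv FF fa fa).
exact: sqrt_continuous.
Qed.

Lemma compact_enorm_ball (R : realType) (n : nat) (N : R) :
  compact [set y : 'rV[R]_n | enorm y <= N].
Proof.
apply: bounded_closed_compact.
  exists N; split; first exact: num_real.
  by move=> M NM y /= yN; rewrite (le_trans (norm_le_enorm _))// (le_trans yN)// ltW.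
have -> : [set y : 'rV[R]_n | enorm y <= N] = (@enorm R n) @^-1` [set r | r <= N] by [].
apply: closed_comp; last exact: closed_le.
by move=> y _; apply: (@cvg_enorm _ _ _ (nbhs y) _ id y); exact: cvg_id.
Qed.

(** * Limits in compact sets *)

(** Compactness in the form of a convergent subsequence: passing to a finer
    filter, obtained from an ultrafilter, keeps every limit already known along
    [F] and makes [f] converge as well. *)
Lemma compact_finer_cvg (T : Type) (V : topologicalType) (F : set_system T)
    (FF : ProperFilter F) (f : T -> V) (K : set V) :
  compact K -> F (f @^-1` K) ->
  exists2 U, ProperFilter U /\ F `<=` U & exists2 y, K y & f @ U --> y.
Proof.
move=> cK FK; have [U [UU FU]] := ultraFilterLemma FF.
exists U; first by split=> //; exact: ultra_proper.
have [y [Ky Cy]] := cK (f @ U) _ (FU _ FK).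
exists y => // A Ay; have [//|UA] := in_ultra_setVsetC (f @^-1` A) UU.
have [z [nAz Az]] := Cy (~` A) A UA Ay.
by have := nAz Az.
Qed.

(** A map with values in a compact set converges as soon as [l] is its only
    possible limit: if it did not, it would stay out of a neighbourhood of [l]
    along a finer filter, and by compactness have another limit there. *)
Lemma cvg_compact_unique (T : Type) (V : topologicalType) (F : set_system T)
    (FF : Filter F) (f : T -> V) (K : set V) (l : V) :
  compact K -> F (f @^-1` K) ->
  (forall U, ProperFilter U -> F `<=` U -> forall y, f @ U --> y -> y = l) ->
  f @ F --> l.
Proof.
move=> cK FK Fl A Al; apply: contrapT => FA.
have PF : ProperFilter (within (~` (f @^-1` A)) F).
  split; last exact: within_filter.
  move=> F0; apply: FA; rewrite /within /= in F0.
  by apply: filterS F0 => x /= nA; apply: contrapT => /nA.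
have subF : F `<=` within (~` (f @^-1` A)) F.
  by move=> B FB; apply: filterS FB => x Bx _.
have [U [UP FU] [y _ fy]] := compact_finer_cvg PF cK (subF _ FK).
have yl := Fl U UP (subset_trans subF FU) y fy.
have UA : U (f @^-1` A) by apply: fy; rewrite yl.
have UnA : U (~` (f @^-1` A)) by apply: FU; apply: filterS FK.
by have [x []] := filter_ex (filterI UA UnA).
Qed.

(** * Continuity of finite convex functions *)

Lemma strictly_convex_le (R : realType) (n : nat) (H : 'rV[R]_n -> R)
    (x y : 'rV[R]_n) (a : R) :
  strictly_convex H -> 0 <= a <= 1 ->
  H (a *: x + (1 - a) *: y) <= a * H x + (1 - a) * H y.
Proof.
move=> sH /andP[]; rewrite le_eqVlt => /predU1P[<- _|a0].
  by rewrite !scale0r subr0 scale1r add0r mul0r mul1r add0r.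
rewrite le_eqVlt => /predU1P[->|a1].
  by rewrite subrr !scale0r !scale1r addr0 mul0r mul1r addr0.
have [->|xy] := eqVneq x y.
  by rewrite -scalerDl -mulrDl !(addrC a) !subrK scale1r mul1r.
by apply/ltW/sH => //; rewrite a0.
Qed.

(** Half of the continuity of a finite convex function.  Along one axis, [H]
    lies below the chord between [x] and [x +- e_i], which gives a one-sided
    Lipschitz bound.  Axes are added one at a time by
    [x + (a + b) = ((x + 2 a) + (x + 2 b)) / 2], which costs a factor 2 in the
    radius [d] and none in the size of the bound. *)
Lemma strictly_convex_upper (R : realType) (n : nat) (H : 'rV[R]_n -> R)
    (x : 'rV[R]_n) (s : seq 'I_n) :
  strictly_convex H ->
  exists C d : R, [/\ 0 <= C, 0 < d & forall (c : 'I_n -> R) (e : R),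
    0 <= e <= d -> (forall i, `|c i| <= e) ->
    H (x + \sum_(i <- s) c i *: delta_mx 0 i) <= H x + C * e].
Proof.
move=> sH; elim: s => [|i s [C [d [C0 d0 IH]]]].
  by exists 0, 1; split=> // c e _ _; rewrite big_nil addr0 mul0r addr0.
(* [M] bounds the slope of [H] at [x] in both directions of axis [i]. *)
pose M := `|H (x + delta_mx 0 i) - H x| + `|H (x - delta_mx 0 i) - H x|.
exists (C + M), (Num.min d 1 / 2); split.
- by rewrite !addr_ge0.
- by rewrite divr_gt0// lt_min d0 ltr01.
move=> c e /andP[e0 ed] ce.
have [ed2 e1] : 2 * e <= d /\ 2 * e <= 1.
  by move: ed; rewrite ler_pdivlMr// mulrC le_min => /andP[].
rewrite big_cons.
have c2e j : `|2 * c j| <= 2 * e by rewrite normrM ger0_norm// ler_pM2l// ce.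
have lei : H (x + (2 * c i) *: delta_mx 0 i) <= H x + 2 * e * M.
  pose t := `|2 * c i|.
  have t01 : 0 <= t <= 1 by rewrite normr_ge0/= (le_trans (c2e i)).
  pose w := if 0 <= 2 * c i then delta_mx 0 i else - delta_mx 0 i : 'rV[R]_n.
  have -> : x + (2 * c i) *: delta_mx 0 i = t *: (x + w) + (1 - t) *: x.
    have -> : (2 * c i) *: delta_mx 0 i = t *: w.
      rewrite /t /w; have [c0|c0] := leP 0 (2 * c i); first by rewrite ger0_norm.
      by rewrite ltr0_norm// scalerN scaleNr opprK.
    rewrite scalerDr scalerBl scale1r [t *: x + _]addrC addrACA subrr addr0.
    exact: addrC.
  apply: le_trans (strictly_convex_le _ _ sH t01) _.
  have wM : H (x + w) - H x <= M.
    rewrite /w /M; case: ifP => _; apply: le_trans (ler_norm _) _.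
      by rewrite lerDl.
    by rewrite lerDr.
  have -> : t * H (x + w) + (1 - t) * H x = H x + t * (H (x + w) - H x) by ring.
  rewrite lerD2l (@le_trans _ _ (t * M))//.
    by rewrite ler_wpM2l// normr_ge0.
  by rewrite ler_wpM2r ?c2e// addr_ge0.
have les := IH (fun j => 2 * c j) (2 * e).
have {}les := les ltac:(by rewrite ed2 mulr_ge0) c2e.
have h01 : 0 <= (2^-1 : R) <= 1 by lra.
have := strictly_convex_le (x + (2 * c i) *: delta_mx 0 i)
  (x + \sum_(j <- s) (2 * c j) *: delta_mx 0 j) sH h01.
have -> : 1 - 2^-1 = 2^-1 :> R by field.
have -> : 2^-1 *: (x + (2 * c i) *: delta_mx 0 i) +
    2^-1 *: (x + \sum_(j <- s) (2 * c j) *: delta_mx 0 j) =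
    x + (c i *: delta_mx 0 i + \sum_(j <- s) c j *: delta_mx 0 j).
  under eq_bigr do rewrite -scalerA.
  rewrite -scaler_sumr !scalerDr !scalerA mulVf ?pnatr_eq0// mulrA mulVf ?pnatr_eq0//.
  rewrite mul1r scale1r addrACA -scalerDl.
  have -> : 2^-1 + 2^-1 = 1 :> R by field.
  by rewrite scale1r.
move=> /le_trans; apply; lra.
Qed.

(** The upper bound holds for [h] and [- h]; midpoint convexity at [x] turns
    the one at [- h] into a lower bound at [h]. *)
Lemma strictly_convex_continuous (R : realType) (n : nat) (H : 'rV[R]_n -> R) :
  strictly_convex H -> continuous H.
Proof.
move=> sH x.
have [C [d [C0 d0 HC]]] := strictly_convex_upper x (index_enum 'I_n) sH.
have up h : `|h| <= d -> H (x + h) <= H x + C * `|h|.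
  move=> hd; rewrite {1}(row_sum_delta h); apply: HC; first by rewrite normr_ge0.
  exact: coord_le_norm.
apply/(@cvgrPdist_le _ _ _ (nbhs x)) => e e0; near=> y.
have yd : `|y - x| <= d.
  by rewrite distrC; near: y; apply: cvgr_dist_le.
have ye : C * `|y - x| <= e.
  have : `|y - x| <= e / (C + 1).
    by rewrite distrC; near: y; apply: cvgr_dist_le => //; rewrite divr_gt0 ?ltr_wpDl.
  rewrite ler_pdivlMr ?ltr_wpDl// => /(le_trans _); apply.
  by rewrite mulrC ler_wpM2l// lerDl.
have u1 := up _ yd.
have u2 := up (- (y - x)); rewrite normrN in u2; have {}u2 := u2 yd.
have h01 : 0 <= (2^-1 : R) <= 1 by lra.
have := strictly_convex_le (x + (y - x)) (x - (y - x)) sH h01.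
have -> : 1 - 2^-1 = 2^-1 :> R by field.
have -> : 2^-1 *: (x + (y - x)) + 2^-1 *: (x - (y - x)) = x.
  rewrite -scalerDr addrACA subrr addr0 scalerDr -scalerDl.
  by have -> : 2^-1 + 2^-1 = 1 :> R; [field | rewrite scale1r].
move=> mid.
rewrite addrC subrK in u1 mid; rewrite ler_norml; lra.
Unshelve. all: by end_near.
Qed.

(** * The Fenchel conjugate and its maximisers *)

(** Outside a ball, uniform for [z] in a bounded set, every competitor does
    worse than [q = 0]. *)
Lemma superlinear_coercive (R : realType) (n : nat) (H : 'rV[R]_n -> R) (A : R) :
  superlinear H -> 0 <= A ->
  exists2 N : R, 0 <= N & forall z q : 'rV[R]_n, `|z| <= A -> N < enorm q ->
    dotv z q - H q < - H 0.
Proof.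
move=> slH A0; have [B HB] := slH (n%:R * A + 1).
exists (Num.max B `|H 0|); first by rewrite le_max normr_ge0 orbT.
move=> z q zA; rewrite gt_max => /andP[/HB Hq Nq].
have q0 : 0 < enorm q by rewrite (le_lt_trans _ Nq).
move: Hq; rewrite ltr_pdivlMr// mulrDl mul1r => Hq.
have zq : dotv z q <= n%:R * A * enorm q.
  apply: le_trans (ler_norm _) (le_trans (norm_dotv_le _ _) _).
  by apply: ler_pM => //; [rewrite ler_wpM2l|exact: norm_le_enorm].
have := ler_norm (H 0); lra.
Qed.

(** Under (H0) this is the subdifferential of the conjugate of [H] at [z]. *)
Definition conj_argmax (R : realType) (n : nat) (H : 'rV[R]_n -> R)
    (z : 'rV[R]_n) : set 'rV[R]_n :=
  [set q | forall v, dotv z v - H v <= dotv z q - H q].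

Lemma cvg_dotvB (R : realType) (n : nat) (H : 'rV[R]_n -> R) (T : Type)
    (F : set_system T) (FF : Filter F) (f g : T -> 'rV[R]_n) (a b : 'rV[R]_n) :
  continuous H -> f @ F --> a -> g @ F --> b ->
  dotv (f x) (g x) - H (g x) @[x --> F] --> dotv a b - H b.
Proof.
move=> cH fa gb; apply: cvgB; first exact: cvg_dotv.
by apply: (cvg_comp g H gb); exact: cH.
Qed.

Lemma conj_argmax_nonempty (R : realType) (n : nat) (H : 'rV[R]_n -> R)
    (z : 'rV[R]_n) :
  condH0 H -> conj_argmax H z !=set0.
Proof.
move=> [sH slH]; have [N N0 HN] := superlinear_coercive slH (normr_ge0 z).
have cH := strictly_convex_continuous sH.
have B0 : [set y : 'rV[R]_n | enorm y <= N] 0 by rewrite /= enorm0.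
have cf : {within [set y : 'rV[R]_n | enorm y <= N],
    continuous (fun v => dotv z v - H v)}.
  apply: continuous_subspaceT => v.
  by apply: (@cvg_dotvB _ _ _ _ (nbhs v) _ _ id) => //; exact: cvg_cst.
have [q _ qmax] := EVT_max_rV (ex_intro _ _ B0) (@compact_enorm_ball R n N) cf.
exists q => v; have [vN|vN] := leP (enorm v) N.
  by apply: qmax; rewrite inE.
apply: le_trans (ltW (HN z v (lexx _) vN)) _.
by have := qmax 0 (mem_set B0); rewrite dotv0r sub0r.
Qed.

(** The midpoint of two distinct maximisers would do strictly better. *)
Lemma conj_argmax_unique (R : realType) (n : nat) (H : 'rV[R]_n -> R)
    (z q q' : 'rV[R]_n) :
  strictly_convex H -> conj_argmax H z q -> conj_argmax H z q' -> q = q'.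
Proof.
move=> sH zq zq'; apply/eqP/negP => /negP qq'.
have h01 : 0 < (2^-1 : R) < 1 by lra.
have := sH q q' 2^-1 qq' h01.
have := zq (2^-1 *: q + (1 - 2^-1) *: q'); have := zq q'; have := zq' q.
rewrite dotvDr !dotvZr; lra.
Qed.

(** The gradient of the conjugate at [z], once [grad_conjugate] is known; the
    default value 0 is never taken under (H0). *)
Definition dual_point (R : realType) (n : nat) (H : 'rV[R]_n -> R)
    (z : 'rV[R]_n) : 'rV[R]_n :=
  xget 0 (conj_argmax H z).

Lemma dual_pointP (R : realType) (n : nat) (H : 'rV[R]_n -> R)
    (z : 'rV[R]_n) :
  condH0 H -> conj_argmax H z (dual_point H z).
Proof.
by move=> hH; have [q zq] := conj_argmax_nonempty z hH; exact: xgetI zq.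
Qed.

Lemma conjugateE (R : realType) (n : nat) (H : 'rV[R]_n -> R)
    (z : 'rV[R]_n) :
  condH0 H ->
  conjugate H z = dotv z (dual_point H z) - H (dual_point H z).
Proof.
move=> hH; have ub : ubound [set dotv z y - H y | y in [set: 'rV[R]_n]]
    (dotv z (dual_point H z) - H (dual_point H z)).
  by move=> _ [v _ <-]; exact: dual_pointP.
apply/eqP; rewrite eq_le ge_sup//=; last by exists (dotv z 0 - H 0), 0.
by apply: ub_le_sup; [eexists; exact: ub | exists (dual_point H z)].
Qed.

Lemma fenchel_young (R : realType) (n : nat) (H : 'rV[R]_n -> R)
    (z q : 'rV[R]_n) :
  condH0 H -> dotv z q - H q <= conjugate H z.
Proof. by move=> hH; rewrite conjugateE//; exact: dual_pointP. Qed.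

(** The first-order upper estimate of the conjugate at [z], with an error that
    is small because the maximiser depends continuously on the point. *)
Lemma conjugate_le_dual (R : realType) (n : nat) (H : 'rV[R]_n -> R)
    (w z : 'rV[R]_n) (q := dual_point H z) :
  condH0 H ->
  conjugate H w <= dotv w q - H q + dotv (w - z) (dual_point H w - q).
Proof.
move=> hH; rewrite conjugateE// dotvBl !dotvBr.
have := dual_pointP z hH (dual_point H w); rewrite -/q; lra.
Qed.

(** By coercivity the maximisers for nearby [w] stay in a compact ball, and
    every limit of them is a maximiser for [z], hence the only one. *)
Lemma dual_point_continuous (R : realType) (n : nat) (H : 'rV[R]_n -> R) :
  condH0 H -> continuous (dual_point H).
Proof.
move=> hH z; have [sH slH] := hH; have cH := strictly_convex_continuous sH.
have A0 : 0 <= `|z| + 1 by rewrite addr_ge0.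
have [N N0 HN] := superlinear_coercive slH A0.
apply: (@cvg_compact_unique _ _ (nbhs z) _ _ _ _ (@compact_enorm_ball R n N)).
  have : \forall w \near nbhs z, `|z - w| <= 1 by exact: cvgr_dist_le.
  apply: filterS => w zw /=; rewrite leNgt; apply/negP => Nw.
  have wA : `|w| <= `|z| + 1.
    by rewrite -lerBlDl (le_trans (lerB_dist _ _))// distrC.
  have := HN w _ wA Nw; have := dual_pointP w hH 0; rewrite dotv0r; lra.
move=> U UP zU y gy.
have idz : id @ U --> z by exact: zU.
apply: (conj_argmax_unique sH (z := z)); last exact: dual_pointP.
move=> v; apply: (ler_cvg_to (a := U)).
- by apply: (cvg_dotvB _ cH idz); exact: cvg_cst.
- exact: (cvg_dotvB _ cH idz gy).
- by apply: nearW => w; exact: dual_pointP.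
Qed.

(** * Differentials from first-order estimates *)

(** A criterion for differentiability by an explicit estimate, which hides the
    little-o calculus. *)
Lemma differentiable_approx (R : realType) (V : normedModType R) (f : V -> R)
    (L : {linear V -> R}) (x : V) :
  continuous L ->
  (forall e : R, 0 < e ->
    \forall y \near nbhs x, `|f y - f x - L (y - x)| <= e * `|y - x|) ->
  differentiable f x.
Proof.
move=> cL fL.
have fo : f \o shift x = cst (f x) + L +o_ 0 id.
  apply/eqaddoP => e e0.
  have := fL e e0; rewrite [\forall y \near _, _ <= _](near_shift 0) subr0 => {}fL.
  apply: filterS fL => y /=; rewrite addrK => fy.
  by rewrite !fctE opprD addrA.
by apply/diff_locallyP; rewrite (diff_unique cL fo).
Qed.

(** A one-sided first-order bound determines the differential: it bounds the
    linear form ['d f x - L] from above by zero, and a linear form bounded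
    above by zero vanishes. *)
Lemma diff_upper (R : realType) (V : normedModType R) (f : V -> R)
    (L : {linear V -> R}) (x : V) :
  differentiable f x ->
  (forall e : R, 0 < e ->
    \forall y \near nbhs x, f y - f x - L (y - x) <= e * `|y - x|) ->
  'd f x = L :> (V -> R).
Proof.
move=> df fL; apply/funext => v.
suff le w : 'd f x w <= L w.
  by apply/eqP; rewrite eq_le le/= -lerN2 -!linearN le.
apply/ler_addgt0Pr => e e0.
(* The error [d] is used twice, once for each expansion at [x]; along [w] the
   two add up to at most [e]. *)
pose d := e / (2 * (`|w| + 1)).
have w1 : 0 < `|w| + 1 by rewrite ltr_wpDl.
have d0 : 0 < d by rewrite divr_gt0// mulr_gt0.
have near1 : \forall y \near nbhs x,
    `|f y - f x - 'd f x (y - x)| <= d * `|y - x|.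
  have /diff_locallyP[_ /eqaddoP/(_ d d0)] := df.
  rewrite [\forall y \near _, _ <= _](near_shift x) sub0r => h; apply: filterS h => y /=.
  by rewrite !fctE /= subrK opprD addrA.
have near2 : nbhs x [set y | `|f y - f x - 'd f x (y - x)| <= d * `|y - x| /\
    f y - f x - L (y - x) <= d * `|y - x|].
  exact: filterI near1 (fL d d0).
have /nbhs_ballP[r /= r0 rP] := near2.
pose s := r / (2 * (`|w| + 1)).
have s0 : 0 < s by rewrite divr_gt0// mulr_gt0.
have sw : s * `|w| < r.
  rewrite /s mulrAC ltr_pdivrMr ?mulr_gt0// ltr_pM2l//.
  by rewrite mulrDr mulr1; have := normr_ge0 w; lra.
have yx : x + s *: w - x = s *: w by rewrite addrAC subrr add0r.
have [|] := rP (x + s *: w).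
  by rewrite -ball_normE /= opprD addNKr normrN normrZ gtr0_norm.
rewrite yx normrZ (gtr0_norm s0) !linearZ /= => h1 h2.
move: h1; rewrite ler_norml => /andP[h1 _].
have : s * 'd f x w <= s * (L w + 2 * d * `|w|).
  by move: h1 h2; rewrite /GRing.scale /=; lra.
rewrite ler_pM2l// => /le_trans; apply; rewrite lerD2l.
have -> : 2 * d * `|w| = e * (`|w| / (`|w| + 1)).
  by rewrite /d; field; rewrite lt0r_neq0.
by rewrite ler_piMr ?(ltW e0)// ler_pdivrMr// mul1r lerDl.
Qed.

(** * Linear forms on space and on space-time *)

Definition dot_right (R : realType) (n : nat) (q : 'rV[R]_n) (x : 'rV[R]_n) : R :=
  dotv x q.

Fact dot_right_linear (R : realType) (n : nat) (q : 'rV[R]_n) :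
  linear (dot_right q).
Proof. by move=> a x y; rewrite /dot_right dotvDl dotvZl. Qed.

HB.instance Definition _ (R : realType) (n : nat) (q : 'rV[R]_n) :=
  GRing.isLinear.Build R 'rV[R]_n R *:%R (dot_right q) (dot_right_linear q).

(** The candidate differentials of [u]: [p] is the time component and [q] the
    space component. *)
Definition covector (R : realType) (n : nat) (p : R) (q : 'rV[R]_n)
    (tx : R * 'rV[R]_n) : R :=
  tx.1 * p + dotv tx.2 q.

Fact covector_linear (R : realType) (n : nat) (p : R) (q : 'rV[R]_n) :
  linear (covector p q).
Proof.
move=> a x y; rewrite /covector /= dotvDl dotvZl /GRing.scale /=; ring.
Qed.

HB.instance Definition _ (R : realType) (n : nat) (p : R) (q : 'rV[R]_n) :=
  GRing.isLinear.Build R (R * 'rV[R]_n)%type R *:%R (covector p q)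
    (covector_linear p q).

Lemma covector_continuous (R : realType) (n : nat) (p : R) (q : 'rV[R]_n) :
  continuous (covector p q).
Proof.
move=> tx; apply: cvgD.
  by apply: cvgM; [exact: cvg_fst | exact: cvg_cst].
by apply: cvg_dotv; [exact: cvg_snd | exact: cvg_cst].
Qed.

Lemma dot_right_continuous (R : realType) (n : nat) (q : 'rV[R]_n) :
  continuous (dot_right q).
Proof.
by move=> x; apply: (@cvg_dotv _ _ _ (nbhs x) _ id) => //; exact: cvg_cst.
Qed.

Lemma partials_covector (R : realType) (n : nat) (u : R * 'rV[R]_n -> R)
    (tx : R * 'rV[R]_n) (p : R) (q : 'rV[R]_n) :
  differentiable u tx -> 'd u tx = covector p q :> (R * 'rV[R]_n -> R) ->
  partial_t u tx = p /\ partial_x u tx = q.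
Proof.
case: tx => t x du uE; split.
  have : 'D_(1, 0) u (t, x) = p.
    by rewrite deriveE// uE /covector /= mul1r dotv0l addr0.
  move=> <-; apply: (congr1 (fun F : R -> R => lim (F @ 0^'))).
  apply/funext => h /=; congr (_ *: (u _ - _)).
  by congr (_, _); rewrite /= ?[_ *: 1]mulr1// scaler0 add0r.
apply/rowP => i; rewrite mxE.
have : 'D_(0, delta_mx 0 i) u (t, x) = q 0 i.
  by rewrite deriveE// uE /covector /= mul0r add0r dotv_deltal.
move=> <-; apply: (congr1 (fun F : R -> R => lim (F @ 0^'))).
apply/funext => h /=; congr (_ *: (u _ - _)).
by congr (_, _); rewrite /= scaler0 add0r.
Qed.

(** * The gradient of the conjugate *)

Lemma conjugate_approx (R : realType) (n : nat) (H : 'rV[R]_n -> R)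
    (z : 'rV[R]_n) (e : R) : condH0 H -> 0 < e ->
  \forall w \near nbhs z, `|conjugate H w - conjugate H z -
      dot_right (dual_point H z) (w - z)| <= e * `|w - z|.
Proof.
move=> hH e0; set q := dual_point H z.
have n1 : 0 < n%:R + 1 :> R by rewrite ltr_wpDl.
have near1 : \forall w \near nbhs z, `|q - dual_point H w| <= e / (n%:R + 1).
  by apply: cvgr_dist_le; [exact: dual_point_continuous | exact: divr_gt0].
apply: filterS near1 => w wq; rewrite /dot_right dotvBl.
have lo := fenchel_young w q hH; have zE := conjugateE z hH.
have hi := conjugate_le_dual w z hH; rewrite -/q in zE hi.
have : dotv (w - z) (dual_point H w - q) <= e * `|w - z|.
  apply: le_trans (ler_norm _) (le_trans (norm_dotv_le _ _) _).
  rewrite distrC in wq.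
  apply: (@le_trans _ _ (n%:R * `|w - z| * (e / (n%:R + 1)))).
    by rewrite ler_wpM2l// mulr_ge0.
  have -> : n%:R * `|w - z| * (e / (n%:R + 1)) =
      e * `|w - z| * (n%:R / (n%:R + 1)).
    by field; rewrite lt0r_neq0.
  by rewrite ler_piMr ?mulr_ge0 ?(ltW e0)// ler_pdivrMr// mul1r lerDl.
move: hi zE lo; rewrite ler_norml; lra.
Qed.

Lemma conjugate_differentiable (R : realType) (n : nat) (H : 'rV[R]_n -> R)
    (z : 'rV[R]_n) : condH0 H -> differentiable (conjugate H) z.
Proof.
move=> hH; apply: (@differentiable_approx _ _ _ (dot_right (dual_point H z))).
  exact: dot_right_continuous.
by move=> e; exact: conjugate_approx.
Qed.

Lemma grad_conjugate (R : realType) (n : nat) (H : 'rV[R]_n -> R)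
    (z : 'rV[R]_n) : condH0 H -> grad (conjugate H) z = dual_point H z.
Proof.
move=> hH; have dH := conjugate_differentiable z hH.
have dE : 'd (conjugate H) z = dot_right (dual_point H z) :> ('rV[R]_n -> R).
  apply: diff_upper => // e e0; apply: filterS (conjugate_approx z hH e0) => w.
  by apply: le_trans; exact: ler_norm.
by apply/rowP => i; rewrite mxE deriveE// dE /dot_right dotv_deltal.
Qed.

(** * The perspective of the conjugate *)

(** With this function the cost of [y] at [(t, x)] is, by conversion,
    [sigma y + perspective H t (x - y)]. *)
Definition perspective (R : realType) (n : nat) (H : 'rV[R]_n -> R) (t : R)
    (x : 'rV[R]_n) : R :=
  t * conjugate H (t^-1 *: x).

(** The Fenchel-Young inequality multiplied by [t]. *)
Lemma perspective_ge (R : realType) (n : nat) (H : 'rV[R]_n -> R) (t : R)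
    (x q : 'rV[R]_n) :
  condH0 H -> 0 < t -> covector (- H q) q (t, x) <= perspective H t x.
Proof.
move=> hH t0; rewrite /perspective /covector /=.
have -> : t * - H q + dotv x q = t * (dotv (t^-1 *: x) q - H q).
  by rewrite dotvZl; field; rewrite lt0r_neq0.
by rewrite ler_pM2l//; exact: fenchel_young.
Qed.

(** At its own dual point the linear form of [perspective_ge] is attained, so
    the perspective is a supremum of linear forms. *)
Lemma perspectiveE (R : realType) (n : nat) (H : 'rV[R]_n -> R) (t : R)
    (x : 'rV[R]_n) (q := dual_point H (t^-1 *: x)) :
  condH0 H -> 0 < t -> perspective H t x = covector (- H q) q (t, x).
Proof.
move=> hH t0; rewrite /perspective /covector /= conjugateE// -/q dotvZl.
by field; rewrite lt0r_neq0.
Qed.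

(** Evaluate on both summands the linear form that is optimal for the sum. *)
Lemma perspective_subadditive (R : realType) (n : nat) (H : 'rV[R]_n -> R)
    (t s : R) (x y : 'rV[R]_n) :
  condH0 H -> 0 < t -> 0 < s ->
  perspective H (t + s) (x + y) <= perspective H t x + perspective H s y.
Proof.
move=> hH t0 s0; rewrite perspectiveE ?addr_gt0//.
set q := dual_point _ _.
have -> : covector (- H q) q (t + s, x + y) =
    covector (- H q) q (t, x) + covector (- H q) q (s, y).
  by rewrite /covector /= dotvDl; ring.
by apply: lerD; exact: perspective_ge.
Qed.

Lemma cvg_dir (R : realType) (n : nat) (T : Type) (F : set_system T)
    (FF : Filter F) (f : T -> R) (g : T -> 'rV[R]_n) (t : R) (x : 'rV[R]_n) :
  t != 0 -> f @ F --> t -> g @ F --> x ->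
  (f y)^-1 *: g y @[y --> F] --> t^-1 *: x.
Proof. by move=> t0 ft gx; apply: cvgZ => //; exact: cvgV. Qed.

(** Together with [perspective_ge] this is the differentiability of the
    perspective.  The error is [dotv (y - s *: z) (dual_point H w - q)] with
    [w = y / s]: its first factor is of the order of the increment and its
    second one tends to 0 by continuity of the dual point. *)
Lemma perspective_le_near (R : realType) (n : nat) (H : 'rV[R]_n -> R)
    (t : R) (x : 'rV[R]_n) (e : R) (q := dual_point H (t^-1 *: x)) :
  condH0 H -> 0 < t -> 0 < e ->
  \forall sy \near nbhs (t, x), perspective H sy.1 sy.2 <=
    covector (- H q) q sy + e * `|sy - (t, x)|.
Proof.
move=> hH t0 e0; set z := t^-1 *: x in q *.
have z1 : 0 < 1 + `|z| by rewrite ltr_pwDl.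
pose d := e / ((n%:R + 1) * (1 + `|z|)).
have n1 : 0 < n%:R + 1 :> R by rewrite ltr_wpDl.
have d0 : 0 < d by rewrite divr_gt0// mulr_gt0.
have near1 : \forall sy \near nbhs (t, x),
    `|q - dual_point H (sy.1^-1 *: sy.2)| <= d.
  apply: cvgr_dist_le => //.
  apply: (cvg_comp (fun sy : R * 'rV[R]_n => sy.1^-1 *: sy.2) (dual_point H)); last first.
    exact: dual_point_continuous.
  by apply: cvg_dir; [rewrite lt0r_neq0 | exact: cvg_fst | exact: cvg_snd].
have near2 : \forall sy \near nbhs (t, x), 0 < sy.1.
  by apply: (cvgr_gt t) => //; exact: cvg_fst.
apply: filterS2 near1 near2 => -[s y] /=; set w := s^-1 *: y => wq s0.
have hi := conjugate_le_dual w z hH; rewrite -/q in hi.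
have {}hi : perspective H s y <=
    covector (- H q) q (s, y) + dotv (y - s *: z) (dual_point H w - q).
  have -> : covector (- H q) q (s, y) + dotv (y - s *: z) (dual_point H w - q)
      = s * (dotv w q - H q + dotv (w - z) (dual_point H w - q)).
    have yE : y = s *: w by rewrite /w scalerA mulfV ?scale1r// lt0r_neq0.
    by rewrite /covector /= {1 2}yE -scalerBr !dotvZl; ring.
  by rewrite /perspective ler_pM2l.
apply: le_trans hi _; rewrite lerD2l.
apply: le_trans (ler_norm _) (le_trans (norm_dotv_le _ _) _).
rewrite distrC in wq.
have ysz : `|y - s *: z| <= (1 + `|z|) * `|(s, y) - (t, x)|.
  have -> : y - s *: z = (y - x) - (s - t) *: z.
    have tz : t *: z = x by rewrite scalerA mulfV ?scale1r// lt0r_neq0.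
    by rewrite scalerBl tz opprB addrA subrK.
  rewrite (le_trans (ler_normB _ _))// normrZ mulrDl mul1r.
  rewrite prod_normE /= lerD ?le_max ?lexx ?orbT// mulrC ler_wpM2l//.
  by rewrite le_max lexx.
apply: (@le_trans _ _ (n%:R * ((1 + `|z|) * `|(s, y) - (t, x)|) * d)).
  by apply: ler_pM => //; exact: ler_wpM2l.
have -> : n%:R * ((1 + `|z|) * `|(s, y) - (t, x)|) * d =
    e * `|(s, y) - (t, x)| * (n%:R / (n%:R + 1)).
  by rewrite /d; field; rewrite !lt0r_neq0.
by rewrite ler_piMr ?mulr_ge0 ?(ltW e0)// ler_pdivrMr// mul1r lerDl.
Qed.

(** * Minimisers of the Hopf-Lax cost *)

Lemma cvg_cost (R : realType) (n : nat) (H sigma : 'rV[R]_n -> R) (T : Type)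
    (F : set_system T) (FF : Filter F) (f : T -> R) (g h : T -> 'rV[R]_n)
    (t : R) (x y : 'rV[R]_n) :
  condH0 H -> continuous sigma -> 0 < t ->
  f @ F --> t -> g @ F --> x -> h @ F --> y ->
  cost H sigma (f k) (g k) (h k) @[k --> F] --> cost H sigma t x y.
Proof.
move=> hH cs t0 ft gx hy; apply: cvgD.
  by apply: (cvg_comp h sigma hy); exact: cs.
apply: cvgM => //.
apply: (cvg_comp (fun k => (f k)^-1 *: (g k - h k)) (conjugate H)); last first.
  exact: differentiable_continuous (conjugate_differentiable _ hH).
by apply: cvg_dir => //; [rewrite lt0r_neq0 | exact: cvgB].
Qed.

(** (H1) confines the infimum to a ball of a radius valid for all nearby
    points, and there continuity and compactness provide a minimiser. *)
Lemma ell_locally_bounded (R : realType) (n : nat) (T : R)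
    (H sigma : 'rV[R]_n -> R) (t0 : R) (x0 : 'rV[R]_n) :
  condH0 H -> condH1 T H sigma -> 0 < t0 < T ->
  exists r N : R, 0 < r /\ forall (t : R) (x : 'rV[R]_n),
    0 < t < T -> `|t - t0| + enorm (x - x0) < r ->
    exists2 y, ell H sigma t x y & enorm y <= N.
Proof.
move=> hH [cs h1] /andP[t00 t0T].
have [|r [N [r0 N0 hN]]] := h1 t0 x0; first by rewrite ltW.
exists r, N; split=> // t x tT txr.
pose K := [set y : 'rV[R]_n | enorm y <= N].
have K0 : K 0 by rewrite /K /= enorm0 ltW.
have cf : {within K, continuous (cost H sigma t x)}.
  apply: continuous_subspaceT => y.
  have t_gt0 : 0 < t by case/andP: tT.
  apply: (@cvg_cost _ _ _ _ _ (nbhs y) _ (fun=> t) (fun=> x) id) => //.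
    exact: cvg_cst.
  exact: cvg_cst.
have [y /set_mem Ky ymin] :=
  EVT_min_rV (ex_intro _ _ K0) (@compact_enorm_ball R n N) cf.
exists y => // z; have [zN|zN] := leP (enorm z) N; first by apply: ymin; rewrite inE.
apply: ltW; apply: le_lt_trans (hN t x z zN tT txr).
apply: lb_le_inf; first by exists (cost H sigma t x 0), 0.
by move=> _ [w Kw <-]; apply: ymin; rewrite inE.
Qed.

Lemma ell_nonempty (R : realType) (n : nat) (T : R)
    (H sigma : 'rV[R]_n -> R) (t : R) (x : 'rV[R]_n) :
  condH0 H -> condH1 T H sigma -> 0 < t < T -> ell H sigma t x !=set0.
Proof.
move=> hH h1 tT; have [r [N [r0 hN]]] := ell_locally_bounded x hH h1 tT.
have [|y ty _] := hN t x tT; last by exists y.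
by rewrite !subrr normr0 enorm0 addr0.
Qed.

Lemma hopf_lax_ge (R : realType) (n : nat) (H sigma : 'rV[R]_n -> R)
    (tx : R * 'rV[R]_n) (c : R) :
  (forall y, c <= cost H sigma tx.1 tx.2 y) -> c <= hopf_lax H sigma tx.
Proof.
move=> cle; apply: lb_le_inf; first by exists (cost H sigma tx.1 tx.2 0), 0.
by move=> _ [y _ <-].
Qed.

Lemma hopf_laxE (R : realType) (n : nat) (H sigma : 'rV[R]_n -> R)
    (t : R) (x y : 'rV[R]_n) :
  ell H sigma t x y -> hopf_lax H sigma (t, x) = cost H sigma t x y.
Proof.
move=> ty; apply/eqP; rewrite eq_le hopf_lax_ge// andbT.
apply: ge_inf; last by exists y.
by exists (cost H sigma t x y) => _ [z _ <-].
Qed.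

Lemma hopf_lax_le (R : realType) (n : nat) (T : R) (H sigma : 'rV[R]_n -> R)
    (tx : R * 'rV[R]_n) (y : 'rV[R]_n) :
  condH0 H -> condH1 T H sigma -> 0 < tx.1 < T ->
  hopf_lax H sigma tx <= cost H sigma tx.1 tx.2 y.
Proof.
case: tx => t x hH h1 tT; have [y0 ty0] := ell_nonempty x hH h1 tT.
by rewrite (hopf_laxE ty0).
Qed.

Lemma Omega_open (R : realType) (n : nat) (T : R) (tx : R * 'rV[R]_n) :
  0 < tx.1 < T -> \forall sw \near nbhs tx, 0 < sw.1 < T.
Proof.
case: tx => t x /= /andP[t0 tT].
have c1 : fst @ nbhs (t, x) --> t by exact: cvg_fst.
have near0 : \forall sw \near nbhs (t, x), 0 < sw.1 by exact: (cvgr_gt t).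
have nearT : \forall sw \near nbhs (t, x), sw.1 < T by exact: (cvgr_lt t).
by apply: filterS2 near0 nearT => sw -> ->.
Qed.

(** * First-order bounds on the Hopf-Lax function *)

(** [u] lies below the cost of the fixed competitor [y], whose differential is
    given by the perspective. *)
Lemma hopf_lax_upper (R : realType) (n : nat) (T : R)
    (H sigma : 'rV[R]_n -> R) (t : R) (x y : 'rV[R]_n) (e : R)
    (q := dual_point H (t^-1 *: (x - y))) :
  condH0 H -> condH1 T H sigma -> 0 < t < T -> ell H sigma t x y -> 0 < e ->
  \forall sw \near nbhs (t, x),
    hopf_lax H sigma sw - hopf_lax H sigma (t, x) -
      covector (- H q) q (sw - (t, x)) <= e * `|sw - (t, x)|.
Proof.
move=> hH h1 tT ty e0; have /andP[t0 _] := tT.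
have shift_cvg : (sw.1, sw.2 - y) @[sw --> (t, x)] --> (t, x - y).
  apply: (@cvg_pair _ _ _ _ (nbhs t) (nbhs (x - y))); first exact: cvg_fst.
  by apply: cvgB; [exact: cvg_snd | exact: cvg_cst].
have near1 : \forall sw \near nbhs (t, x), perspective H sw.1 (sw.2 - y) <=
    covector (- H q) q (sw.1, sw.2 - y) + e * `|(sw.1, sw.2 - y) - (t, x - y)|.
  exact: shift_cvg _ (perspective_le_near (x - y) hH t0 e0).
have near2 := @Omega_open _ _ T (t, x) tT.
apply: filterS2 near1 near2 => -[s w] /= hsw sT.
rewrite (hopf_laxE ty).
have : hopf_lax H sigma (s, w) <= sigma y + perspective H s (w - y).
  exact: (@hopf_lax_le _ _ _ _ _ (s, w) y hH h1 sT).
have -> : cost H sigma t x y = sigma y + perspective H t (x - y) by [].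
rewrite (perspectiveE _ hH t0) -/q.
have dE : (s, w - y) - (t, x - y) = (s, w) - (t, x).
  by congr (_, _); rewrite /= opprB addrA subrK.
have : covector (- H q) q ((s, w) - (t, x)) =
    covector (- H q) q (s, w - y) - covector (- H q) q (t, x - y).
  by rewrite -dE linearB.
rewrite dE in hsw; lra.
Qed.

(** Any minimiser determines the gradient of [u] where it exists. *)
Lemma hopf_lax_gradient (R : realType) (n : nat) (T : R)
    (H sigma : 'rV[R]_n -> R) (t : R) (x y : 'rV[R]_n)
    (q := dual_point H (t^-1 *: (x - y))) :
  condH0 H -> condH1 T H sigma -> 0 < t < T -> ell H sigma t x y ->
  differentiable (hopf_lax H sigma) (t, x) ->
  partial_t (hopf_lax H sigma) (t, x) = - H q /\
  partial_x (hopf_lax H sigma) (t, x) = q.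
Proof.
move=> hH h1 tT ty du; apply: partials_covector => //.
by apply: diff_upper => // e e0; exact: (hopf_lax_upper hH h1 tT ty e0).
Qed.

(** On the segment [y0 + t z] from [y0] at time 0 to [x0] at time [t0] the
    remaining and the elapsed displacements both have velocity [z], so that the
    same dual point serves at all times. *)
Lemma characteristic (R : realType) (n : nat) (t0 t : R) (x0 y0 : 'rV[R]_n)
    (z := t0^-1 *: (x0 - y0)) (x := y0 + t *: z) :
  0 < t0 -> x0 - x = (t0 - t) *: z /\ x - y0 = t *: z.
Proof.
move=> t00; rewrite /x addrAC subrr add0r; split=> //.
have tz : t0 *: z = x0 - y0 by rewrite scalerA mulfV ?scale1r// lt0r_neq0.
by rewrite scalerBl tz opprD addrA.
Qed.

(** The half of the dynamic programming principle that needs convexity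
    only: a direct path costs no more than one through [x] at time [t]. *)
Lemma hopf_lax_step (R : realType) (n : nat) (H sigma : 'rV[R]_n -> R)
    (t0 t : R) (x0 x y : 'rV[R]_n) :
  condH0 H -> 0 < t < t0 ->
  cost H sigma t0 x0 y <= cost H sigma t x y + perspective H (t0 - t) (x0 - x).
Proof.
move=> hH /andP[t_gt0 tt0]; rewrite /cost -/(perspective _ _ _) -addrA lerD2l.
have -> : x0 - y = (x - y) + (x0 - x) by rewrite [RHS]addrC addrA subrK.
rewrite -{1}(subrK t t0) [t0 - t + t]addrC.
by apply: perspective_subadditive => //; rewrite subr_gt0.
Qed.

(** Along the segment the inequality of [hopf_lax_step] is an equality for
    [y0], because both parts have the same velocity; hence a better competitor
    at time [t] would be a better one at time [t0]. *)
Lemma ell_characteristic (R : realType) (n : nat) (H sigma : 'rV[R]_n -> R)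
    (t0 t : R) (x0 y0 : 'rV[R]_n)
    (z := t0^-1 *: (x0 - y0)) (x := y0 + t *: z) :
  condH0 H -> 0 < t < t0 -> ell H sigma t0 x0 y0 ->
  cost H sigma t0 x0 y0 =
    cost H sigma t x y0 + perspective H (t0 - t) (x0 - x) /\
  ell H sigma t x y0.
Proof.
move=> hH tt0 ty0; have /andP[t_gt0 t_lt] := tt0.
have t00 := lt_trans t_gt0 t_lt; have [x0x xy0] := characteristic t x0 y0 t00.
have split_cost : cost H sigma t0 x0 y0 =
    cost H sigma t x y0 + perspective H (t0 - t) (x0 - x).
  rewrite /cost /perspective -/z xy0 x0x !scalerK ?lt0r_neq0 ?subr_gt0//.
  by ring.
split=> // y; have := hopf_lax_step sigma x0 x y hH tt0.
have := ty0 y; rewrite split_cost; lra.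
Qed.

(** The upper bound by the cost of [y0] and the lower bound by
    [u(t0,x0) - perspective H (t0 - s) (x0 - w)] have the same value and the
    same differential at the point of the segment, since both perspectives are
    expanded at velocity [z]. *)
Lemma hopf_lax_differentiable (R : realType) (n : nat) (T : R)
    (H sigma : 'rV[R]_n -> R) (t0 t : R) (x0 y0 : 'rV[R]_n)
    (z := t0^-1 *: (x0 - y0)) (x := y0 + t *: z) :
  condH0 H -> condH1 T H sigma -> 0 < t < t0 -> t0 < T ->
  ell H sigma t0 x0 y0 -> differentiable (hopf_lax H sigma) (t, x).
Proof.
move=> hH h1 tt0 t0T ty0; have /andP[t_gt0 t_lt] := tt0.
have t00 := lt_trans t_gt0 t_lt; have [x0x xy0] := characteristic t x0 y0 t00.
have [split_cost ty] := ell_characteristic hH tt0 ty0.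
have tT : 0 < t < T by rewrite t_gt0 (lt_trans t_lt).
have tt0' : 0 < t0 - t by rewrite subr_gt0.
have zE : z = t^-1 *: (x - y0) by rewrite xy0 scalerK// lt0r_neq0.
have zE' : z = (t0 - t)^-1 *: (x0 - x).
  by rewrite x0x scalerK// lt0r_neq0.
pose q := dual_point H z.
apply: (@differentiable_approx _ _ _ (covector (- H q) q)).
  exact: covector_continuous.
move=> e e0.
have near_up := hopf_lax_upper hH h1 tT ty e0; rewrite -zE -/q in near_up.
(* The increments of [(t0 - s, x0 - w)] are opposite to those of [(s, w)]; as
   the perspective enters the lower bound with a minus sign, the same covector
   appears. *)
have back_cvg : (t0 - sw.1, x0 - sw.2) @[sw --> (t, x)] --> (t0 - t, x0 - x).
  apply: (@cvg_pair _ _ _ _ (nbhs (t0 - t)) (nbhs (x0 - x))); apply: cvgB; try exact: cvg_cst.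
    exact: cvg_fst.
  exact: cvg_snd.
have near_back := back_cvg _ (perspective_le_near (x0 - x) hH tt0' e0).
have near_t : \forall sw \near nbhs (t, x), 0 < sw.1 < t0.
  exact: (@Omega_open _ _ t0 (t, x)).
near=> sw.
have up : hopf_lax H sigma sw - hopf_lax H sigma (t, x) -
    covector (- H q) q (sw - (t, x)) <= e * `|sw - (t, x)| by near: sw.
rewrite ler_norml up andbT.
have st : 0 < sw.1 < t0 by near: sw.
have lo : cost H sigma t0 x0 y0 - perspective H (t0 - sw.1) (x0 - sw.2) <=
    hopf_lax H sigma sw.
  apply: hopf_lax_ge => y; have := hopf_lax_step sigma x0 sw.2 y hH st.
  have := ty0 y; lra.
have : perspective H (t0 - sw.1) (x0 - sw.2) <=
    covector (- H q) q (t0 - sw.1, x0 - sw.2) +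
    e * `|(t0 - sw.1, x0 - sw.2) - (t0 - t, x0 - x)|.
  by rewrite /q zE'; near: sw.
have dE : (t0 - sw.1, x0 - sw.2) - (t0 - t, x0 - x) = - (sw - (t, x)).
  by congr (_, _); rewrite /= !opprB addrC addrA subrK.
have : covector (- H q) q (- (sw - (t, x))) =
    covector (- H q) q (t0 - sw.1, x0 - sw.2) -
    covector (- H q) q (t0 - t, x0 - x).
  by rewrite -dE linearB.
rewrite linearN dE normrN (hopf_laxE ty).
move: split_cost; rewrite (perspectiveE _ hH tt0') -zE' -/q; lra.
Unshelve. all: by end_near.
Qed.

(** * Reachable gradients *)

(** The gradient is constant on the segment that ends at [(t0, x0)]. *)
Lemma calH_reachable (R : realType) (n : nat) (T : R)
    (H sigma : 'rV[R]_n -> R) (t0 : R) (x0 : 'rV[R]_n) :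
  condH0 H -> condH1 T H sigma -> 0 < t0 < T ->
  calH H sigma t0 x0 `<=` reachable_gradients T (hopf_lax H sigma) (t0, x0).
Proof.
move=> hH h1 /andP[t00 t0T] _ [y0 ty0 /= ->]; rewrite grad_conjugate//.
set z := t0^-1 *: (x0 - y0); set q := dual_point H z.
(* The shift of the harmonic sequence keeps [t k] positive at [k = 0]. *)
pose t k := t0 * (1 - harmonic k.+1).
pose s k := (t k, y0 + t k *: z).
have harmonic01 k : 0 < (harmonic k.+1 : R) < 1.
  by rewrite /harmonic /= invr_gt0 ltr0Sn invf_lt1 ?ltr1n ?ltr0Sn.
have tt0 k : 0 < t k < t0.
  have /andP[h0 h1'] := harmonic01 k.
  by rewrite /t pmulr_rgt0// subr_gt0 h1' /= gtr_pMr// gtrDl oppr_lt0.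
have ct : t @ \oo --> t0.
  have -> : t0 = t0 * (1 - 0) by rewrite subr0 mulr1.
  apply: cvgM; first exact: cvg_cst.
  apply: cvgB; first exact: cvg_cst.
  by have := @cvg_harmonic R; rewrite -(cvg_shiftS (@harmonic R)).
have ds k : differentiable (hopf_lax H sigma) (s k).
  exact: hopf_lax_differentiable hH h1 (tt0 k) t0T ty0.
exists s; split=> //.
- move=> k; have /andP[tk0 tkt0] := tt0 k; split.
    by rewrite /Omega /= tk0 (lt_trans tkt0).
  by apply/eqP => -[] /eqP; rewrite lt_eqF.
- apply: (@cvg_pair _ _ _ _ (nbhs t0) (nbhs x0)) => //.
  have x0E : x0 = y0 + t0 *: z.
    by rewrite scalerKV ?lt0r_neq0// addrC subrK.
  suff : y0 + t k *: z @[k --> \oo] --> y0 + t0 *: z by rewrite -x0E.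
  apply: cvgD; first exact: cvg_cst.
  by apply: cvgZ => //; exact: cvg_cst.
have gradE k : (partial_t (hopf_lax H sigma) (s k),
    partial_x (hopf_lax H sigma) (s k)) = (- H q, q).
  have /andP[tk0 tkt0] := tt0 k.
  have tkT : 0 < t k < T by rewrite tk0 (lt_trans tkt0).
  have [_ tky] := ell_characteristic hH (tt0 k) ty0.
  have [-> ->] := hopf_lax_gradient hH h1 tkT tky (ds k).
  by have [_ ->] := characteristic (t k) x0 y0 t00; rewrite scalerK// lt0r_neq0.
by under eq_fun do rewrite gradE; exact: cvg_cst.
Qed.

(** The minimisers along the sequence have a limit point by (H1); it minimises
    the cost at [(t0, x0)] since the cost is jointly continuous. *)
Lemma reachable_calH (R : realType) (n : nat) (T : R)
    (H sigma : 'rV[R]_n -> R) (t0 : R) (x0 : 'rV[R]_n) :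
  condH0 H -> condH1 T H sigma -> 0 < t0 < T ->
  reachable_gradients T (hopf_lax H sigma) (t0, x0) `<=` calH H sigma t0 x0.
Proof.
move=> hH h1 t0T pq [s [s_Omega s_diff cs cgrad]].
have /andP[t00 _] := t0T; have [csigma _] := h1.
have [r [N [r0 hN]]] := ell_locally_bounded x0 hH h1 t0T.
have ct : (s k).1 @[k --> \oo] --> t0.
  by apply: (cvg_comp s fst cs); exact: cvg_fst.
have cx : (s k).2 @[k --> \oo] --> x0.
  by apply: (cvg_comp s snd cs); exact: cvg_snd.
have dist_cvg : `|(s k).1 - t0| + enorm ((s k).2 - x0) @[k --> \oo] --> (0 : R).
  rewrite -[X in _ --> X]addr0; apply: cvgD.
    rewrite -(normr0 R) -(subrr t0); apply: cvg_norm.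
    by apply: cvgB => //; exact: cvg_cst.
  rewrite -(enorm0 R n) -(subrr x0); apply: cvg_enorm.
  by apply: cvgB => //; exact: cvg_cst.
pose y k := xget 0 (ell H sigma (s k).1 (s k).2 `&` [set y | enorm y <= N]).
have yP : \forall k \near \oo,
    ell H sigma (s k).1 (s k).2 (y k) /\ enorm (y k) <= N.
  have near_r : \forall k \near \oo, `|(s k).1 - t0| + enorm ((s k).2 - x0) < r.
    exact: (cvgr_lt (0 : R)).
  apply: filterS near_r => k /(hN _ _ (s_Omega k).1)[v sv vN].
  have svN : (ell H sigma (s k).1 (s k).2 `&` [set y | enorm y <= N]) v by [].
  exact: xgetI svN.
have near_K : \forall k \near \oo, [set y : 'rV[R]_n | enorm y <= N] (y k).
  by apply: filterS yP => k [].
have [U [UP ooU] [y0 _ cy]] :=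
  compact_finer_cvg _ (@compact_enorm_ball R n N) near_K.
have ctU : (s k).1 @[k --> U] --> t0 by apply: cvg_trans ct; exact: cvg_app.
have cxU : (s k).2 @[k --> U] --> x0 by apply: cvg_trans cx; exact: cvg_app.
have ty0 : ell H sigma t0 x0 y0.
  move=> z; apply: (ler_cvg_to (a := U)).
  - exact: (cvg_cost _ hH csigma t00 ctU cxU cy).
  - by apply: (cvg_cost _ hH csigma t00 ctU cxU); exact: cvg_cst.
  - by apply: ooU; apply: filterS yP => k [+ _]; apply.
exists y0 => //=; rewrite grad_conjugate//.
pose qk k := dual_point H ((s k).1^-1 *: ((s k).2 - y k)).
set q := dual_point H _.
have cq : qk @ U --> q.
  apply: (cvg_comp (fun k => (s k).1^-1 *: ((s k).2 - y k)) (dual_point H)); last first.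
    exact: dual_point_continuous.
  by apply: cvg_dir => //; [rewrite lt0r_neq0 | exact: cvgB].
have cHq : (- H (qk k), qk k) @[k --> U] --> (- H q, q).
  apply: (@cvg_pair _ _ _ _ (nbhs (- H q)) (nbhs q)) => //.
  apply: cvgN; apply: (cvg_comp qk H cq).
  by case: hH => sH _; exact: strictly_convex_continuous.
have cgradU : (partial_t (hopf_lax H sigma) (s k),
    partial_x (hopf_lax H sigma) (s k)) @[k --> U] --> pq.
  by apply: cvg_trans cgrad; exact: cvg_app.
apply: (cvg_unique _ cgradU); first exact: norm_hausdorff.
apply: cvg_trans cHq; apply: near_eq_cvg; apply: ooU.
apply: filterS yP => k [sy _].
have := s_diff k; have := (s_Omega k).1; rewrite /qk.
case: (s k) sy => t x /= ty tT du.
by have [-> ->] := hopf_lax_gradient hH h1 tT ty du.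
Qed.

Theorem theorem3p9 (R : realType) (n : nat) (T : R) (H sigma : 'rV[R]_n -> R)
    (hT : 0 < T) (hH0 : condH0 H) (hH1 : condH1 T H sigma)
    (t0 : R) (x0 : 'rV[R]_n) (htx0 : Omega T (t0, x0)) :
  reachable_gradients T (hopf_lax H sigma) (t0, x0) = calH H sigma t0 x0.
Proof.
by apply/seteqP; split; [exact: reachable_calH | exact: calH_reachable].
Qed.
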